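(* Let $\mathbb{K}$ be $\mathbb{Q}$, $\mathbb{R}$, or $\alpha(\mathbb{Z})$ for a strictly increasing map $\alpha:\mathbb{Z}\to\mathbb{R}$ whose image contains $0$ and is invariant under integer translations. For the Fock space action of $\mathbf{U}_\upsilon(\mathfrak{sl}(S^1_{\mathbb{K}}))$ on $\mathcal{F}_{\mathbb{K}}$, the subspace $\mathbf{U}_\upsilon(\mathfrak{sl}(S^1_{\mathbb{K}}))\cdot|0\rangle$ of $\mathcal{F}_{\mathbb{K}}$ is strict, i.e. $\mathbf{U}_\upsilon(\mathfrak{sl}(S^1_{\mathbb{K}}))\cdot|0\rangle\subsetneq\mathcal{F}_{\mathbb{K}}$.
   Context: Ground field: $F=\mathbb{Q}(\upsilon^{1/2})$. $S^1_{\mathbb{K}}=\mathbb{K}/\mathbb{Z}$, with projection $\pi_{\mathbb{K}}$. Step functions. $\mathbb{F}(\mathbb{K})$ is the set of right-continuous piecewise constant functions $f:\mathbb{R}\to\mathbb{Z}$ with bounded support and finitely many discontinuities, all in $\mathbb{K}$. A $\mathbb{K}$-interval is $[a,b[$ with $a<b$ in $\mathbb{K}$; $\mathbf 1_I$ is the characteristic function of $I$. With $h_\pm(x)=\lim_{t\to0,t>0}h(x\pm t)$ put $\langle f,g\rangle=\sum_x f_-(x)(g_-(x)-g_+(x))$ and $(f,g)=\langle f,g\rangle+\langle g,f\rangle$; the same formulas define forms on $\mathbb{F}(S^1_{\mathbb{K}})$, the right-continuous piecewise constant $\mathbb{Z}$-valued functions on $\mathbb{R}/\mathbb{Z}$ with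 finitely many discontinuities, all in $S^1_{\mathbb{K}}$. Pyramids. A $\mathbb{K}$-pyramid is $p\in\mathbb{F}(\mathbb{K})$ with values in $\mathbb{N}$ such that $p(0)=\max p$, $p$ is weakly increasing on $x\le0$ and weakly decreasing on $x\ge0$, and $|p_+(x)-p_-(x)|\le1$ for all $x$. $\mathsf{Pyr}(\mathbb{K})$ is the set of $\mathbb{K}$-pyramids; $0$ is the zero pyramid; $\mathcal{F}_{\mathbb{K}}=\bigoplus_{p\in\mathsf{Pyr}(\mathbb{K})}F|p\rangle$. A $\mathbb{K}$-interval $I$ is addable to (resp. removable from) $p$ if $p+\mathbf 1_I$ (resp. $p-\mathbf 1_I$) is a $\mathbb{K}$-pyramid. $n_I(p)=1,-1,0$ according to whether $I$ is addable, removable, neither. With $\tau_m([a,b[)=[a+m,b+m[$: $n^>_I(p)=\sum_{m\ge1}n_{\tau_m(I)}(p)$, $n^<_I(p)=\sum_{m\ge1}n_{\tau_{-m}(I)}(p)$, $\overline n_I(p)=\sum_{m\in\mathbb{Z}}n_{\tau_m(I)}(p)$; for an interval $J$ of the circle, $\overline n_J(p)=\overline n_I(p)$ for any lift $I=[a,b[$, $b-a\le1$. For $I=[a,b[$, $I'=[c,d[$ write $I<I'$ if $b<c$. Intervals of the circle are images of $\mathbb{K}$-intervals $[a,b[$ with $b-a\le1$; strict means not the whole circle; $J\to J'$ means $J\cap J'=\emptyset$, $\overline J\cap J'\neq\emptyset$, and $J\cup J'$ is an interval. The algebra $\mathbf{U}_\upsilon(\mathfrak{sl}(S^1_{\mathbb{K}}))$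 is the unital $F$-algebra generated by $E_J,F_J$ ($J$ strict), $K_J^{\pm1}$ ($J$ any interval), $K_JK_J^{-1}=K_J^{-1}K_J=1$, with relations: (1) $[K_{I_1},K_{I_2}]=0$, $K_IE_JK_I^{-1}=\upsilon^{(\mathbf 1_I,\mathbf 1_J)}E_J$, $K_IF_JK_I^{-1}=\upsilon^{-(\mathbf 1_I,\mathbf 1_J)}F_J$, $[E_{J_1},F_{J_2}]=0$ if $J_1\cap J_2=\emptyset$, $[E_J,F_J]=\frac{K_J-K_J^{-1}}{\upsilon-\upsilon^{-1}}$; (2) if $J_1\to J_2$: $K_{J_1}K_{J_2}=K_{J_1\cup J_2}$, and if moreover $J_1\cup J_2$ is strict, $E_{J_1\cup J_2}=\upsilon^{1/2}E_{J_1}E_{J_2}-\upsilon^{-1/2}E_{J_2}E_{J_1}$, $F_{J_1\cup J_2}=\upsilon^{-1/2}F_{J_2}F_{J_1}-\upsilon^{1/2}F_{J_1}F_{J_2}$; (3) if $\overline{J_1}\cap\overline{J_2}=\emptyset$: $[E_{J_1},E_{J_2}]=0=[F_{J_1},F_{J_2}]$; if $J_1\subseteq J_2$: $\upsilon^{\langle\mathbf 1_{J_1},\mathbf 1_{J_2}\rangle}E_{J_1}E_{J_2}=\upsilon^{\langle\mathbf 1_{J_2},\mathbf 1_{J_1}\rangle}E_{J_2}E_{J_1}$ and likewise for $F$. The Fock space action on $\mathcal{F}_{\mathbb{K}}$ (known to be a well-defined action) is $$E_J|p\rangle=\sum(-\upsilon^{1/2})^{\ell}\upsilon^{\frac{\ell-1}{2}-\sum_i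 n^<_{J'_i}(p)}(-\upsilon)^{-\sum_i\langle\mathbf 1_{J'_i},p\rangle}(\upsilon-\upsilon^{-1})^{\ell-1}\Big|p-\sum_i\mathbf 1_{J'_i}\Big\rangle,$$ $$F_J|p\rangle=\sum\upsilon^{\frac{\ell}{2}+\frac{\ell-1}{2}+\sum_i n^>_{J''_i}(p)}(-\upsilon)^{\sum_i\langle\mathbf 1_{J''_i},p\rangle}(\upsilon^{-1}-\upsilon)^{\ell-1}\Big|p+\sum_i\mathbf 1_{J''_i}\Big\rangle,$$ $$K_J|p\rangle=\upsilon^{\overline n_J(p)}|p\rangle,$$ the first sum over all tuples ($\ell\ge1$) of removable intervals $J'_1>\cdots>J'_\ell$ with $\pi_{\mathbb{K}}(J'_1)\to\cdots\to\pi_{\mathbb{K}}(J'_\ell)$ and $\pi_{\mathbb{K}}(J'_1)\sqcup\cdots\sqcup\pi_{\mathbb{K}}(J'_\ell)=J$; the second over all tuples of addable intervals $J''_1<\cdots<J''_\ell$ with $\pi_{\mathbb{K}}(J''_1)\to\cdots\to\pi_{\mathbb{K}}(J''_\ell)$ and $\pi_{\mathbb{K}}(J''_1)\sqcup\cdots\sqcup\pi_{\mathbb{K}}(J''_\ell)=J$. *)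

(* Defs.v *)
From HB Require Import structures.
From mathcomp Require Import all_boot all_order all_algebra.
From mathcomp Require Import all_classical all_reals all_analysis.
(* The notations of multinomials clash with those of MathComp-Analysis. *)
From mathcomp Require Import -(notations) monalg.

Set Implicit Arguments.
Unset Strict Implicit.
Unset Printing Implicit Defensive.

Import Order.TTheory GRing.Theory Num.Theory.
Import numFieldNormedType.Exports.

Local Open Scope classical_set_scope.
Local Open Scope ring_scope.

(* Q(upsilon^(1/2)) is the field of rational functions in the indeterminate   *)
(* upsilon_half = upsilon^(1/2).                                              *)
Definition qfield : fieldType := {fraction {poly rat}}.
Definition upsilon_half : qfield := tofrac 'X.
Definition upsilon : qfield := upsilon_half ^+ 2.

Definition admissible (R : realType) (K : set R) : Prop :=
  [\/ K = range (ratr : rat -> R),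
      K = [set: R] |
      exists alpha : int -> R,
        [/\ {homo alpha : m n / m < n},
            range alpha 0,
            forall (x : R) (m : int), range alpha x -> range alpha (x + m%:~R) &
            K = range alpha]].

Section StepFunctions.
Variable R : realType.

Definition circle :=
  Quotient.quot (GRing.ZmodClosed.clone R (@Num.int_num_subdef R) _).
HB.instance Definition _ := GRing.Zmodule.on circle.

Definition circle_proj (x : R) : circle := (\pi_circle x)%qT.

Definition circle_closure (A : set circle) : set circle :=
  closure (A : set (quotient_topology circle)).

(* The definitions below serve both the line (X := R, i := idfun) and the     *)
(* circle (X := circle R, i := circle_proj).                                  *)
(* A Z-valued function tends to c iff it is eventually equal to c.            *)
Definition rlim (X : zmodType) (i : R -> X) (h : X -> int) (x : X) : int :=
  xget 0 [set c | \forall t \near (0 : R)^'+, h (x + i t) = c].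
Definition llim (X : zmodType) (i : R -> X) (h : X -> int) (x : X) : int :=
  xget 0 [set c | \forall t \near (0 : R)^'+, h (x - i t) = c].

Definition eform (X : zmodType) (i : R -> X) (f g : X -> int) : int :=
  \sum_(x \in [set: X]) llim i f x * (llim i g x - rlim i g x).
Definition sform (X : zmodType) (i : R -> X) (f g : X -> int) : int :=
  eform i f g + eform i g f.

Definition line_eform (f g : R -> int) : int := eform idfun f g.
Definition circle_eform (A B : set circle) : int :=
  eform circle_proj \1_A \1_B.
Definition circle_sform (A B : set circle) : int :=
  sform circle_proj \1_A \1_B.

Variable K : set R.

Definition discontinuities (f : R -> int) : set R :=
  [set x | ~ \forall t \near x, f t = f x].

(* Piecewise constancy follows from the first two fields.                     *)
Record step_function (f : R -> int) : Prop := {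
  step_right_continuous : forall x, \forall t \near x^'+, f t = f x;
  step_finite : finite_set (discontinuities f);
  step_disc : discontinuities f `<=` K;
  step_bounded_support : exists M, forall x, M < `|x| -> f x = 0
}.

Record is_pyramid (p : R -> int) : Prop := {
  pyr_step : step_function p;
  pyr_ge0 : forall x, 0 <= p x;
  pyr_max : forall x, p x <= p 0;
  pyr_incr : forall x y, x <= y -> y <= 0 -> p x <= p y;
  pyr_decr : forall x y, 0 <= x -> x <= y -> p y <= p x;
  pyr_jump : forall x, `|rlim idfun p x - llim idfun p x| <= 1
}.

Definition pyramid := {p : R -> int | `[< is_pyramid p >]}.

(* A pair I = (a, b) stands for the interval [a, b[. *)
Definition interval_set (I : R * R) : set R := `[I.1, I.2[%classic.
Definition is_Kinterval (I : R * R) : Prop := [/\ K I.1, K I.2 & I.1 < I.2].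

Definition addable (p : R -> int) (I : R * R) : Prop :=
  is_Kinterval I /\ is_pyramid (fun x => p x + \1_(interval_set I) x).
Definition removable (p : R -> int) (I : R * R) : Prop :=
  is_Kinterval I /\ is_pyramid (fun x => p x - \1_(interval_set I) x).

Definition nI (p : R -> int) (I : R * R) : int :=
  if `[< addable p I >] then 1 else if `[< removable p I >] then -1 else 0.

Definition tau (m : int) (I : R * R) : R * R := (I.1 + m%:~R, I.2 + m%:~R).

Definition n_gt (p : R -> int) (I : R * R) : int :=
  \sum_(m \in [set m : int | 1 <= m]) nI p (tau m I).
Definition n_lt (p : R -> int) (I : R * R) : int :=
  \sum_(m \in [set m : int | 1 <= m]) nI p (tau (- m) I).
Definition nbar (p : R -> int) (I : R * R) : int :=
  \sum_(m \in [set: int]) nI p (tau m I).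

Definition interval_lt : rel (R * R) := fun I I' => I.2 < I'.1.

Definition arc_of (I : R * R) : set circle := circle_proj @` interval_set I.

Definition is_lift (J : set circle) (I : R * R) : Prop :=
  [/\ is_Kinterval I, I.2 - I.1 <= 1 & J = arc_of I].
Definition is_arc (J : set circle) : Prop := exists I, is_lift J I.

Record circle_arc := CircleArc { arc_set :> set circle; _ : is_arc arc_set }.
Record strict_arc := StrictArc {
  strict_arc_arc :> circle_arc; _ : arc_set strict_arc_arc <> [set: circle] }.

Definition arrow (J J' : set circle) : Prop :=
  [/\ J `&` J' = set0, circle_closure J `&` J' !=set0 & is_arc (J `|` J')].

(* The value does not depend on the choice of a lift. *)
Definition nbar_arc (p : R -> int) (J : set circle) : int :=
  nbar p (xget (0, 0) (is_lift J)).

(* J is the disjoint union of the arcs of s = [:: I_1; ...; I_l], and         *)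
(* I_1 -> ... -> I_l on the circle.                                           *)
Definition arrow_chain (J : set circle) (s : seq (R * R)) : Prop :=
  [/\ s <> [::],
      sorted (fun I I' => `[< arrow (arc_of I) (arc_of I') >]) s,
      pairwise (fun I I' => `[< arc_of I `&` arc_of I' = set0 >]) s &
      \bigcup_(I in [set` s]) arc_of I = J].

Definition E_chains (p : R -> int) (J : set circle) : set (seq (R * R)) :=
  [set s | [/\ forall I, I \in s -> removable p I,
               sorted (fun I I' => interval_lt I' I) s & arrow_chain J s]].
Definition F_chains (p : R -> int) (J : set circle) : set (seq (R * R)) :=
  [set s | [/\ forall I, I \in s -> addable p I,
               sorted interval_lt s & arrow_chain J s]].

Definition Fock := malg pyramid qfield.
HB.instance Definition _ := GRing.Lmodule.on Fock.

Definition ket (p : pyramid) : Fock := mkmalgU p 1.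

(* |f>, for a function f which is expected to be a pyramid (0 otherwise). *)
Definition ket_fun (f : R -> int) : Fock :=
  if insub f is Some p then ket p else 0.

(* The sums below range over finite sets. *)
Definition E_op (J : set circle) (p : pyramid) : Fock :=
  \sum_(s \in E_chains (val p) J)
    ((- upsilon_half) ^+ size s *
     (upsilon_half ^+ (size s).-1 *
        upsilon ^ (- \sum_(I <- s) n_lt (val p) I)) *
     (- upsilon) ^ (- \sum_(I <- s) line_eform \1_(interval_set I) (val p)) *
     (upsilon - upsilon^-1) ^+ (size s).-1) *:
    ket_fun (fun x => val p x - \sum_(I <- s) \1_(interval_set I) x).

Definition F_op (J : set circle) (p : pyramid) : Fock :=
  \sum_(s \in F_chains (val p) J)
    ((upsilon_half ^+ size s * upsilon_half ^+ (size s).-1 *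
        upsilon ^ (\sum_(I <- s) n_gt (val p) I)) *
     (- upsilon) ^ (\sum_(I <- s) line_eform \1_(interval_set I) (val p)) *
     (upsilon^-1 - upsilon) ^+ (size s).-1) *:
    ket_fun (fun x => val p x + \sum_(I <- s) \1_(interval_set I) x).

Definition K_op (J : set circle) (p : pyramid) : Fock :=
  upsilon ^ nbar_arc (val p) J *: ket p.

Lemma zero_is_pyramid : is_pyramid (fun=> 0).
Proof.
have lim0 x : rlim idfun (fun=> 0) x = 0 /\ llim idfun (fun=> 0) x = 0.
  rewrite /rlim /llim; split; case: xgetP => // c _ /= H;
    by case: (@filter_ex _ _ (at_right_proper_filter (0 : R)) _ H).
have disc0 : discontinuities (fun=> 0) = set0.
  by rewrite -subset0 => x; apply; exact: (@filterE _ (nbhs x)).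
split=> // [|x]; last by have [-> ->] := lim0 x.
split; rewrite ?disc0 //; last by exists 0.
by move=> x; exact: (@filterE _ (x^'+)).
Qed.

Definition zero_pyramid : pyramid :=
  exist (fun p => `[< is_pyramid p >]) (fun=> 0) (asboolT zero_is_pyramid).

(* The algebra Uq presented by generators and relations is the quotient of    *)
(* the formal expressions by the smallest congruence which contains the       *)
(* axioms of unital algebras over qfield and the defining relations.          *)
Inductive generator :=
| GenE of strict_arc | GenF of strict_arc
| GenK of circle_arc | GenKinv of circle_arc.

Inductive expr :=
| Gen of generator | Zero | One | Opp of expr | Add of expr & expr
| Mul of expr & expr | Scale of qfield & expr.

Declare Scope expr_scope.
Delimit Scope expr_scope with E.
Local Notation "0" := Zero : expr_scope.
Local Notation "1" := One : expr_scope.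
Local Notation "- x" := (Opp x) : expr_scope.
Local Notation "x + y" := (Add x y) : expr_scope.
Local Notation "x - y" := (Add x (Opp y)) : expr_scope.
Local Notation "x * y" := (Mul x y) : expr_scope.
Local Notation "c *: x" := (Scale c%R x) : expr_scope.
Local Notation "[ x , y ]" := (x * y - y * x)%E : expr_scope.
Bind Scope expr_scope with expr.

Definition gE (J : strict_arc) := Gen (GenE J).
Definition gF (J : strict_arc) := Gen (GenF J).
Definition gK (J : circle_arc) := Gen (GenK J).
Definition gKinv (J : circle_arc) := Gen (GenKinv J).

Local Open Scope expr_scope.

Inductive Urel : expr -> expr -> Prop :=
| rel_KKinv (J : circle_arc) : Urel (gK J * gKinv J) 1
| rel_KinvK (J : circle_arc) : Urel (gKinv J * gK J) 1
| rel_KK (I1 I2 : circle_arc) : Urel [gK I1, gK I2] 0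
| rel_KE (I : circle_arc) (J : strict_arc) :
    Urel (gK I * gE J * gKinv I) (upsilon ^ circle_sform I J *: gE J)
| rel_KF (I : circle_arc) (J : strict_arc) :
    Urel (gK I * gF J * gKinv I) (upsilon ^ (- circle_sform I J) *: gF J)
| rel_EF_disjoint (J1 J2 : strict_arc) :
    J1 `&` J2 = set0 -> Urel [gE J1, gF J2] 0
| rel_EF (J : strict_arc) :
    Urel [gE J, gF J] ((upsilon - upsilon^-1)^-1 *: (gK J - gKinv J))
| rel_K_join (J1 J2 J : circle_arc) :
    arrow J1 J2 -> J1 `|` J2 = J -> Urel (gK J1 * gK J2) (gK J)
| rel_E_join (J1 J2 J : strict_arc) :
    arrow J1 J2 -> J1 `|` J2 = J ->
    Urel (gE J)
      (upsilon_half *: (gE J1 * gE J2) - upsilon_half^-1 *: (gE J2 * gE J1))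
| rel_F_join (J1 J2 J : strict_arc) :
    arrow J1 J2 -> J1 `|` J2 = J ->
    Urel (gF J)
      (upsilon_half^-1 *: (gF J2 * gF J1) - upsilon_half *: (gF J1 * gF J2))
| rel_EE_disjoint (J1 J2 : strict_arc) :
    circle_closure J1 `&` circle_closure J2 = set0 ->
    Urel [gE J1, gE J2] 0
| rel_FF_disjoint (J1 J2 : strict_arc) :
    circle_closure J1 `&` circle_closure J2 = set0 ->
    Urel [gF J1, gF J2] 0
| rel_EE_nested (J1 J2 : strict_arc) :
    J1 `<=` J2 ->
    Urel (upsilon ^ circle_eform J1 J2 *: (gE J1 * gE J2))
         (upsilon ^ circle_eform J2 J1 *: (gE J2 * gE J1))
| rel_FF_nested (J1 J2 : strict_arc) :
    J1 `<=` J2 ->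
    Urel (upsilon ^ circle_eform J1 J2 *: (gF J1 * gF J2))
         (upsilon ^ circle_eform J2 J1 *: (gF J2 * gF J1)).

Inductive Ucong : expr -> expr -> Prop :=
| cong_rel x y : Urel x y -> Ucong x y
| cong_refl x : Ucong x x
| cong_sym x y : Ucong x y -> Ucong y x
| cong_trans x y z : Ucong x y -> Ucong y z -> Ucong x z
| cong_opp x x' : Ucong x x' -> Ucong (- x) (- x')
| cong_add x x' y y' : Ucong x x' -> Ucong y y' -> Ucong (x + y) (x' + y')
| cong_mul x x' y y' : Ucong x x' -> Ucong y y' -> Ucong (x * y) (x' * y')
| cong_scale c x x' : Ucong x x' -> Ucong (c *: x) (c *: x')
| cong_addA x y z : Ucong (x + (y + z)) (x + y + z)
| cong_addC x y : Ucong (x + y) (y + x)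
| cong_add0 x : Ucong (0 + x) x
| cong_addN x : Ucong (- x + x) 0
| cong_mulA x y z : Ucong (x * (y * z)) (x * y * z)
| cong_mul1l x : Ucong (1 * x) x
| cong_mul1r x : Ucong (x * 1) x
| cong_mulDl x y z : Ucong ((x + y) * z) (x * z + y * z)
| cong_mulDr x y z : Ucong (x * (y + z)) (x * y + x * z)
| cong_scaleA c d x : Ucong (c *: (d *: x)) ((c * d)%R *: x)
| cong_scale1 x : Ucong (1 *: x) x
| cong_scaleDr c x y : Ucong (c *: (x + y)) (c *: x + c *: y)
| cong_scaleDl x c d : Ucong ((c + d)%R *: x) (c *: x + d *: x)
| cong_scaleAl c x y : Ucong (c *: (x * y)) (c *: x * y)
| cong_scaleAr c x y : Ucong (c *: (x * y)) (x * (c *: y)).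

HB.instance Definition _ := gen_eqMixin expr.
HB.instance Definition _ := gen_choiceMixin expr.

Definition congb : rel expr := fun x y => `[< Ucong x y >].

Fact congb_equiv : equiv_class_of congb.
Proof.
split=> [x|x y|y x z]; first exact/asboolP/cong_refl.
  by apply/asboolP/asboolP => /cong_sym.
by move=> /asboolP xy /asboolP yz; apply/asboolP/(cong_trans xy).
Qed.
Canonical congb_equivRel := EquivRelPack congb_equiv.

Definition Uq : Type := {eq_quot congb}%qT.
HB.instance Definition _ := Quotient.on Uq.
HB.instance Definition _ := Choice.on Uq.
HB.instance Definition _ := EqQuotient.on Uq.

Definition Ucls (x : expr) : Uq := (\pi_Uq x)%qT.

Lemma Ucls_eq x y : Ucls x = Ucls y <-> Ucong x y.
Proof.
by split=> [/eqmodP /asboolP //|xy]; apply/eqmodP/asboolP.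
Qed.

Lemma Uq_ind (P : Uq -> Prop) : (forall x, P (Ucls x)) -> forall u, P u.
Proof. exact: quotW. Qed.

Lemma repr_cong x : Ucong (repr (Ucls x)) x.
Proof. by apply/Ucls_eq; rewrite /Ucls reprK. Qed.

Definition Uopp (a : Uq) := Ucls (- repr a).
Definition Uadd (a b : Uq) := Ucls (repr a + repr b).
Definition Umul (a b : Uq) := Ucls (repr a * repr b).
Definition Uscale c (a : Uq) := Ucls (c *: repr a).

Lemma UoppE x : Uopp (Ucls x) = Ucls (- x).
Proof. by apply/Ucls_eq/cong_opp/repr_cong. Qed.
Lemma UaddE x y : Uadd (Ucls x) (Ucls y) = Ucls (x + y).
Proof. by apply/Ucls_eq/cong_add; apply: repr_cong. Qed.
Lemma UmulE x y : Umul (Ucls x) (Ucls y) = Ucls (x * y).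
Proof. by apply/Ucls_eq/cong_mul; apply: repr_cong. Qed.
Lemma UscaleE c x : Uscale c (Ucls x) = Ucls (c *: x).
Proof. by apply/Ucls_eq/cong_scale/repr_cong. Qed.
Let UE := (UoppE, UaddE, UmulE, UscaleE).

Fact UaddA : associative Uadd.
Proof. by do 3!elim/Uq_ind=> ?; rewrite !UE; exact/Ucls_eq/cong_addA. Qed.
Fact UaddC : commutative Uadd.
Proof. by do 2!elim/Uq_ind=> ?; rewrite !UE; exact/Ucls_eq/cong_addC. Qed.
Fact Uadd0 : left_id (Ucls 0) Uadd.
Proof. by elim/Uq_ind=> ?; rewrite !UE; exact/Ucls_eq/cong_add0. Qed.
Fact UaddN : left_inverse (Ucls 0) Uopp Uadd.
Proof. by elim/Uq_ind=> ?; rewrite !UE; exact/Ucls_eq/cong_addN. Qed.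
HB.instance Definition _ := GRing.isZmodule.Build Uq UaddA UaddC Uadd0 UaddN.

Fact UmulA : associative Umul.
Proof. by do 3!elim/Uq_ind=> ?; rewrite !UE; exact/Ucls_eq/cong_mulA. Qed.
Fact Umul1l : left_id (Ucls 1) Umul.
Proof. by elim/Uq_ind=> ?; rewrite !UE; exact/Ucls_eq/cong_mul1l. Qed.
Fact Umul1r : right_id (Ucls 1) Umul.
Proof. by elim/Uq_ind=> ?; rewrite !UE; exact/Ucls_eq/cong_mul1r. Qed.
Fact UmulDl : left_distributive Umul Uadd.
Proof. by do 3!elim/Uq_ind=> ?; rewrite !UE; exact/Ucls_eq/cong_mulDl. Qed.
Fact UmulDr : right_distributive Umul Uadd.
Proof. by do 3!elim/Uq_ind=> ?; rewrite !UE; exact/Ucls_eq/cong_mulDr. Qed.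

Local Close Scope expr_scope.

(* The counit E_J, F_J |-> 0, K_J |-> 1 shows that Uq is not trivial. *)
Fixpoint counit (x : expr) : qfield :=
  match x with
  | Gen (GenE _) | Gen (GenF _) | Zero => 0
  | Gen (GenK _) | Gen (GenKinv _) | One => 1
  | Opp x => - counit x
  | Add x y => counit x + counit y
  | Mul x y => counit x * counit y
  | Scale c x => c * counit x
  end.

Lemma counit_cong x y : Ucong x y -> counit x = counit y.
Proof.
elim=> {x y} //=.
- move=> x y; case=> {x y} /= *;
    by rewrite ?(mulr0, mul0r, mulr1, mul1r, subrr, oppr0, addr0).
- by move=> x y z _ -> _ ->.
- by move=> x x' _ ->.
- by move=> x x' y y' _ -> _ ->.
- by move=> x x' y y' _ -> _ ->.
- by move=> c x x' _ ->.
- by move=> *; rewrite addrA.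
- by move=> *; rewrite addrC.
- by move=> *; rewrite add0r.
- by move=> *; rewrite addNr.
- by move=> *; rewrite mulrA.
- by move=> *; rewrite mul1r.
- by move=> *; rewrite mulr1.
- by move=> *; rewrite mulrDl.
- by move=> *; rewrite mulrDr.
- by move=> *; rewrite mulrA.
- by move=> *; rewrite mul1r.
- by move=> *; rewrite mulrDr.
- by move=> *; rewrite mulrDl.
- by move=> *; rewrite mulrA.
- by move=> *; rewrite mulrCA.
Qed.

Fact Uone_neq0 : Ucls 1 != Ucls 0.
Proof. by apply/eqP => /Ucls_eq /counit_cong /= /eqP; rewrite oner_eq0. Qed.

HB.instance Definition _ := GRing.Zmodule_isNzRing.Build Uq
  UmulA Umul1l Umul1r UmulDl UmulDr Uone_neq0.

Fact UscaleA c d (a : Uq) : Uscale c (Uscale d a) = Uscale (c * d) a.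
Proof. by elim/Uq_ind: a => ?; rewrite !UE; exact/Ucls_eq/cong_scaleA. Qed.
Fact Uscale1 : left_id 1 Uscale.
Proof. by elim/Uq_ind=> ?; rewrite !UE; exact/Ucls_eq/cong_scale1. Qed.
Fact UscaleDr : right_distributive Uscale Uadd.
Proof.
by move=> c; do 2!elim/Uq_ind=> ?; rewrite !UE; exact/Ucls_eq/cong_scaleDr.
Qed.
Fact UscaleDl a c d : Uscale (c + d) a = Uadd (Uscale c a) (Uscale d a).
Proof. by elim/Uq_ind: a => ?; rewrite !UE; exact/Ucls_eq/cong_scaleDl. Qed.
HB.instance Definition _ := GRing.Zmodule_isLmodule.Build qfield Uq
  UscaleA Uscale1 UscaleDr UscaleDl.

Fact UscaleAl c a b : Uscale c (Umul a b) = Umul (Uscale c a) b.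
Proof.
elim/Uq_ind: a => ?; elim/Uq_ind: b => ?; rewrite !UE.
exact/Ucls_eq/cong_scaleAl.
Qed.
HB.instance Definition _ := GRing.Lmodule_isLalgebra.Build qfield Uq UscaleAl.

Fact UscaleAr c a b : Uscale c (Umul a b) = Umul a (Uscale c b).
Proof.
elim/Uq_ind: a => ?; elim/Uq_ind: b => ?; rewrite !UE.
exact/Ucls_eq/cong_scaleAr.
Qed.
HB.instance Definition _ := GRing.Lalgebra_isAlgebra.Build qfield Uq UscaleAr.

Record is_Fock_action (act : Uq -> Fock -> Fock) : Prop := {
  act_linear : forall u, linear (act u);
  act_linearl : forall w, linear (act^~ w);
  act_one : forall w, act 1 w = w;
  act_mul : forall u u' w, act (u * u') w = act u (act u' w);
  act_E : forall (J : strict_arc) p, act (Ucls (gE J)) (ket p) = E_op J p;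
  act_F : forall (J : strict_arc) p, act (Ucls (gF J)) (ket p) = F_op J p;
  act_K : forall (J : circle_arc) p, act (Ucls (gK J)) (ket p) = K_op J p
}.

End StepFunctions.

Definition Uorbit (R : realType) (K : set R) (act : Uq K -> Fock K -> Fock K)
  (w : Fock K) : set (Fock K) := [set act u w | u in [set: Uq K]].

(* Main.v *)
Require Import Defs.
From mathcomp Require Import all_boot all_order all_algebra.
From mathcomp Require Import all_classical all_reals all_analysis.
From mathcomp Require Import zify lra.
From mathcomp Require Import -(notations) monalg.

(** The orbit of the vacuum [|0>] is proper because it lies in the kernel of a
    nonzero linear form: [unit_form] takes the value 1 on the pyramids that are
    the indicator of an interval [[a, a + 1[] and 0 on all other pyramids.

    The heart of the matter is that [unit_form] kills the image of every
    [F_J] ([unit_form_F_op]).  If adding the intervals of a chain to a pyramid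
    [p] produces an interval of length one, then, as [J] is not the whole
    circle, [p] is itself an interval [[c, d[] with [c <= 0 < d < c + 1], and
    the chain consists of the single interval [[d, c + 1[] or of the single
    interval [[d - 1, c[] ([unit_chainP]); filling both sides at once would
    leave, on the circle, a gap between the two arcs.  Both intervals lift the
    same arc, so both occur in [F_J |p>].  Their coefficients are [v^(1/2)] and
    [v^(1/2) * v * (- v)^-1 = - v^(1/2)]: the left interval has an addable
    translate to its right, and its right end meets the left end of [p].
    The two contributions cancel.

    It remains to see that [U |0>] is spanned by [|0>] and vectors of the form
    [F_J w].  The defining relations only give the commutator of [E_J] and
    [F_J'] for equal or disjoint arcs.  But for one given element of [U], the
    circle may be cut at the finitely many endpoints of the arcs occurring in
    it; two of the resulting elementary arcs are equal or disjoint, and the join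
    relations express the generators of the given element through elementary
    ones.  So the span [Fspan] of the words in elementary [F]'s applied to [|0>]
    is stable under the given element ([Fspan_expr]), as the [E]'s kill
    [|0>]. *)

Set Implicit Arguments.
Unset Strict Implicit.
Unset Printing Implicit Defensive.

Import Order.TTheory GRing.Theory Num.Theory.
Import numFieldNormedType.Exports.

Local Open Scope classical_set_scope.
Local Open Scope ring_scope.

(** * Indicators of intervals *)

Section Line.
Variable R : realType.
Implicit Types (a b x y t : R) (I : R * R) (h : R -> int) (c : int).

Lemma indic_itvE I x :
  \1_(interval_set I) x = ((I.1 <= x) && (x < I.2))%:R :> int.
Proof. by rewrite indicE /interval_set mem_setE in_itv. Qed.

Lemma itv_in a b x : a <= x -> x < b -> \1_(interval_set (a, b)) x = 1 :> int.
Proof. by move=> ax xb; rewrite indic_itvE ax xb. Qed.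

Lemma itv_before a b x : x < a -> \1_(interval_set (a, b)) x = 0 :> int.
Proof. by move=> xa; rewrite indic_itvE /= leNgt xa. Qed.

Lemma itv_after a b x : b <= x -> \1_(interval_set (a, b)) x = 0 :> int.
Proof. by move=> bx; rewrite indic_itvE /= [x < b]ltNge bx andbF. Qed.

Lemma indic_itv_inj a b a' b' : a < b -> a' < b' ->
  (forall x, \1_(interval_set (a, b)) x =
             \1_(interval_set (a', b')) x :> int) ->
  a = a' /\ b = b'.
Proof.
move=> ab ab' e.
have sub a1 b1 a2 b2 : a1 < b1 ->
    (forall x, \1_(interval_set (a1, b1)) x =
               \1_(interval_set (a2, b2)) x :> int) -> a2 <= a1 /\ b1 <= b2.
  move=> ab1 e1; split; rewrite leNgt; apply/negP => h.
    by have := e1 a1; rewrite itv_in // itv_before.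
  have := e1 (Num.max a1 b2); rewrite itv_in; last 2 first.
  - by rewrite le_max lexx.
  - by rewrite gt_max ab1.
  by rewrite itv_after // le_max lexx orbT.
have [] := sub _ _ _ _ ab e; have [] := sub _ _ _ _ ab' (fun x => esym (e x)).
by move=> *; split; apply/eqP; rewrite eq_le; apply/andP.
Qed.

Lemma indic_itv_cat a t b x : a <= t -> t <= b ->
  \1_(interval_set (a, t)) x + \1_(interval_set (t, b)) x =
  \1_(interval_set (a, b)) x :> int.
Proof.
move=> at_ tb; rewrite !indic_itvE /=; have [xt|tx] := ltP x t.
  by rewrite (lt_le_trans xt tb) !andbT addr0.
by rewrite (le_trans at_ tx) andbF add0r.
Qed.

(** The one-sided limits are chosen with [xget]; a value is pinned down by the
    fact that right neighbourhoods of 0 are proper filters. *)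
Lemma limit_value h (k : int) (f : R -> R) :
  (\forall t \near 0^'+, h (f t) = k) ->
  xget 0 [set c | \forall t \near 0^'+, h (f t) = c] = k.
Proof.
move=> hc; case: xgetP => [c _ /= hc'|/(_ k)]; last by case.
have [t [<- <-]] : exists t, h (f t) = c /\ h (f t) = k; last by [].
by apply: (@filter_ex _ _ (at_right_proper_filter (0 : R))); exact: filterI.
Qed.

Lemma rlim_value h (k : int) x :
  (\forall t \near 0^'+, h (x + t) = k) -> rlim idfun h x = k.
Proof. exact: limit_value. Qed.

Lemma llim_value h (k : int) x :
  (\forall t \near 0^'+, h (x - t) = k) -> llim idfun h x = k.
Proof. exact: limit_value. Qed.

Lemma near_right_cmp (k x : R) :
  \forall t \near 0^'+, (k <= x + t) = (k <= x) /\ (x + t < k) = (x < k).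
Proof.
have [xk|kx] := ltP x k; near=> t.
  have t0 : 0 < t by near: t; exact: nbhs_right_gt.
  have tk : t < k - x by near: t; apply: nbhs_right_lt; rewrite subr_gt0.
  have xtk : x + t < k by lra.
  by rewrite xtk leNgt xtk.
have t0 : 0 < t by near: t; exact: nbhs_right_gt.
have kxt : k <= x + t by lra.
by rewrite kxt ltNge kxt.
Unshelve. all: by end_near. Qed.

Lemma near_left_cmp (k x : R) :
  \forall t \near 0^'+, (k <= x - t) = (k < x) /\ (x - t < k) = (x <= k).
Proof.
have [kx|xk] := ltP k x; near=> t.
  have t0 : 0 < t by near: t; exact: nbhs_right_gt.
  have tk : t < x - k by near: t; apply: nbhs_right_lt; rewrite subr_gt0.
  have kxt : k <= x - t by lra.
  by rewrite kxt ltNge kxt.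
have t0 : 0 < t by near: t; exact: nbhs_right_gt.
have kxt : x - t < k by lra.
by rewrite kxt leNgt kxt.
Unshelve. all: by end_near. Qed.

Lemma near_cmp (k x : R) : x != k ->
  \forall t \near x, (k <= t) = (k <= x) /\ (t < k) = (x < k).
Proof.
rewrite neq_lt => /orP[xk|kx]; near=> t.
  have tk : t < k by near: t; exact: lt_nbhsl.
  by rewrite tk xk !leNgt tk xk.
have tk : k < t by near: t; exact: lt_nbhsr.
by rewrite !ltNge (ltW tk) (ltW kx).
Unshelve. all: by end_near. Qed.

Lemma rlim_itv a b x :
  rlim idfun \1_(interval_set (a, b)) x = ((a <= x) && (x < b))%:R.
Proof.
apply: rlim_value; near=> t; rewrite indic_itvE /=.
have [-> _] : (a <= x + t) = (a <= x) /\ (x + t < a) = (x < a).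
  by near: t; exact: near_right_cmp.
have [_ ->] // : (b <= x + t) = (b <= x) /\ (x + t < b) = (x < b).
by near: t; exact: near_right_cmp.
Unshelve. all: by end_near. Qed.

Lemma llim_itv a b x :
  llim idfun \1_(interval_set (a, b)) x = ((a < x) && (x <= b))%:R.
Proof.
apply: llim_value; near=> t; rewrite indic_itvE /=.
have [-> _] : (a <= x - t) = (a < x) /\ (x - t < a) = (x <= a).
  by near: t; exact: near_left_cmp.
have [_ ->] // : (b <= x - t) = (b < x) /\ (x - t < b) = (x <= b).
by near: t; exact: near_left_cmp.
Unshelve. all: by end_near. Qed.

Lemma line_eform_itv a b (c d : R) :
  line_eform \1_(interval_set (a, b)) \1_(interval_set (c, d)) =
  \sum_(x \in [set: R]) (((a < x) && (x <= b))%:R *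
    (((c < x) && (x <= d))%:R - ((c <= x) && (x < d))%:R) : int).
Proof.
by apply: eq_fsbigr => x _; rewrite !llim_itv !rlim_itv.
Qed.

Variable K : set R.

Lemma itv_is_pyramid a b : K a -> K b -> a <= 0 -> 0 < b ->
  is_pyramid K \1_(interval_set (a, b)).
Proof.
move=> Ka Kb a0 b0.
have disc : discontinuities \1_(interval_set (a, b)) `<=` [set a; b].
  move=> x; rewrite /discontinuities /= => disc.
  apply: contrapT => /not_orP [/eqP xa /eqP xb]; apply: disc.
  near=> t; rewrite !indic_itvE /=.
  have [-> _] : (a <= t) = (a <= x) /\ (t < a) = (x < a).
    by near: t; exact: near_cmp.
  have [_ ->] // : (b <= t) = (b <= x) /\ (t < b) = (x < b).
  by near: t; exact: near_cmp.
split.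
- split=> //.
  + move=> x; apply/nbhs_right0P; near=> t; rewrite !indic_itvE /=.
    have [-> _] : (a <= x + t) = (a <= x) /\ (x + t < a) = (x < a).
      by near: t; exact: near_right_cmp.
    have [_ ->] // : (b <= x + t) = (b <= x) /\ (x + t < b) = (x < b).
    by near: t; exact: near_right_cmp.
  + by apply: sub_finite_set disc _; exact: finite_set2.
  + by move=> x /disc [->|->].
  + exists (Num.max (- a) b) => x; rewrite gt_max indic_itvE /= => /andP[H1 H2].
    suff -> : (a <= x) && (x < b) = false by [].
    apply/negP => /andP[H3 H4]; move: H1 H2.
    by case: (ger0P x); lra.
- by move=> x; rewrite indic_itvE.
- by move=> x; rewrite !indic_itvE /= a0 b0; case: (_ && _).
- move=> x y xy y0; rewrite !indic_itvE ler_nat /=.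
  case: (boolP (_ && _)) => // /andP[H1 H2].
  by case: (boolP (_ && _)) => // /negP[]; apply/andP; split; lra.
- move=> x y x0 xy; rewrite !indic_itvE ler_nat /=.
  case: (boolP (_ && _)) => // /andP[H1 H2].
  by case: (boolP (_ && _)) => // /negP[]; apply/andP; split; lra.
- move=> x; rewrite rlim_itv llim_itv.
  by case: (_ && _); case: (_ && _).
Unshelve. all: by end_near. Qed.

End Line.

(** * Arcs of the circle *)

Section Circle.
Variable R : realType.
Implicit Types (a b x y t : R) (I : R * R).

Lemma circle_proj_eq x y :
  circle_proj x = circle_proj y <-> exists m : int, y = x + m%:~R.
Proof.
split=> [/eqP|[m ->]]; last first.
  apply/esym/eqP; rewrite /circle_proj -Quotient.idealrBE addrAC subrr add0r.
  exact: intr_int.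
rewrite eq_sym /circle_proj -Quotient.idealrBE => /intrP[m xy].
by exists m; rewrite -xy; lra.
Qed.

Lemma arc_ofP I y : arc_of I (circle_proj y) <->
  exists m : int, I.1 <= y + m%:~R < I.2.
Proof.
split=> [[x /= xI /esym/circle_proj_eq [m xy]]|[m yI]].
  by exists m; rewrite -xy; move: xI; rewrite /interval_set /= in_itv.
exists (y + m%:~R); first by rewrite /interval_set /= in_itv.
by apply/esym/circle_proj_eq; exists m.
Qed.

Lemma circle_projP (z : circle R) : exists x, z = circle_proj x.
Proof. by elim/quotW: z => x; exists x. Qed.

Lemma arc_eqP (A B : set (circle R)) :
  (forall y, A (circle_proj y) <-> B (circle_proj y)) -> A = B.
Proof.
by move=> AB; apply/seteqP; split=> z; have [x ->] := circle_projP z; apply AB.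
Qed.

Lemma arc_of_tau m I : arc_of (tau m I) = arc_of I.
Proof.
apply: arc_eqP => y; rewrite !arc_ofP /=; split=> -[n yn].
  by exists (n - m); rewrite rmorphB /=; lra.
by exists (n + m); rewrite rmorphD /=; lra.
Qed.

Lemma arc_of_full a : arc_of (a, a + 1) = [set: circle R].
Proof.
apply: arc_eqP => y; rewrite arc_ofP; split=> // _.
exists (- Num.floor (y - a)); rewrite /= rmorphN /=.
have := floor_itv (y - a).
by rewrite intrD; lra.
Qed.

Lemma int_lt1 (m : int) : -1 < m%:~R :> R -> m%:~R < 1 :> R -> m = 0.
Proof.
rewrite -[1]/(1%:~R) -mulrNz !ltr_int; lia.
Qed.

Lemma arc_of_neqT a b : b < a + 1 -> arc_of (a, b) <> [set: circle R].
Proof.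
move=> ba JT.
have : arc_of (a, b) (circle_proj b) by rewrite JT.
move=> /arc_ofP[m /= /andP[am mb]].
have m0 : m = 0 by apply: int_lt1; lra.
by rewrite m0 in mb; lra.
Qed.

Lemma arc_of_split a t b : a < t -> t < b ->
  arc_of (a, t) `|` arc_of (t, b) = arc_of (a, b).
Proof.
move=> at_ tb; apply: arc_eqP => y; rewrite arc_ofP; split.
  by move=> [/arc_ofP[m /= ym]|/arc_ofP[m /= ym]]; exists m; lra.
move=> [m /= ym]; have [yt|ty] := ltP (y + m%:~R) t.
  by left; apply/arc_ofP; exists m => /=; lra.
by right; apply/arc_ofP; exists m => /=; lra.
Qed.

Lemma arc_of_disjoint a b c d : a <= b -> b <= c -> c <= d -> d <= a + 1 ->
  arc_of (a, b) `&` arc_of (c, d) = set0.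
Proof.
move=> ab bc cd da; rewrite -subset0 => z.
have [y ->] := circle_projP z => -[/arc_ofP[m /= ym] /arc_ofP[n /= yn]].
have mn : n - m = 0 by apply: int_lt1; rewrite rmorphB /=; lra.
have : n = m by lia.
by move=> nm; rewrite nm in yn; lra.
Qed.

(** The topology of the circle is final for the projection, so open sets are
    tested upstairs. *)
Lemma circle_closureP (A : set (circle R)) y :
  circle_closure A (circle_proj y) <->
  forall U : set (circle R), open (@circle_proj R @^-1` U) ->
    U (circle_proj y) -> A `&` U !=set0.
Proof.
split=> [cl U oU Uy|H].
  by apply: cl; apply: (@open_nbhs_nbhs (quotient_topology (circle R))).
move=> B; rewrite nbhsE => -[U [oU Uy] UB].
have [z [Az Uz]] := H U oU Uy.
by exists z; split=> //; exact: UB.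
Qed.

Lemma arrow_split (K : set R) a t b :
  K a -> K b -> a < t -> t < b -> b <= a + 1 ->
  arrow K (arc_of (a, t)) (arc_of (t, b)).
Proof.
move=> Ka Kb at_ tb ba; split.
- by apply: arc_of_disjoint => //; exact: ltW.
- exists (circle_proj t); split; last first.
    by apply/arc_ofP; exists 0; rewrite /= addr0 lexx.
  apply/circle_closureP => U oU Ut.
  have [x [xa xt Ux]] : exists x, [/\ a < x, x < t & U (circle_proj x)].
    near (t^'-) => x; exists x; split; near: x.
    + exact: nbhs_left_gt.
    + exact: nbhs_left_lt.
    + by apply: cvg_within; apply: open_nbhs_nbhs.
  exists (circle_proj x); split=> //.
  by apply/arc_ofP; exists 0; rewrite /= addr0 (ltW xa).
- exists (a, b); split=> //=.
  + by split=> //=; lra.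
  + by lra.
  + exact: arc_of_split.
Unshelve. all: by end_near. Qed.

(** The image of []c, a + 1[] is an open set which contains the second arc and
    misses the first one. *)
Lemma not_arrow_gap (K : set R) a c d : a < c -> c < d -> d < a + 1 ->
  ~ arrow K (arc_of (a, c)) (arc_of (d, a + 1)).
Proof.
move=> ac cd da [_ [z [+ +]] _].
have [y ->] := circle_projP z => /circle_closureP cl /arc_ofP[m /= ym].
set U : set (circle R) := @circle_proj R @` `]c, a + 1[.
have UP x : U (circle_proj x) <-> exists m : int, c < x + m%:~R < a + 1.
  split=> [[x' /= xI /esym/circle_proj_eq [n xy]]|[n yI]].
    by exists n; rewrite -xy; move: xI; rewrite in_itv.
  exists (x + n%:~R); first by rewrite /= in_itv.
  by apply/esym/circle_proj_eq; exists n.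
have : arc_of (a, c) `&` U !=set0.
  apply: cl; last by apply/UP; exists m; lra.
  have -> : @circle_proj R @^-1` U =
      \bigcup_(n : int) [set x | c < x + n%:~R < a + 1].
    apply/seteqP; split=> x /=.
      by move/UP => [n xn]; exists n.
    by move=> [n _ xn]; apply/UP; exists n.
  apply: bigcup_open => n _.
  have -> : [set x | c < x + n%:~R < a + 1] =
      `]c - n%:~R, a + 1 - n%:~R[%classic.
    by apply/seteqP; split=> x /=; rewrite in_itv /=; lra.
  exact: interval_open.
move=> [z' []]; have [x ->] := circle_projP z' => /arc_ofP[i /= xi] /UP[j xj].
have ij : j - i = 0 by apply: int_lt1; rewrite rmorphB /=; lra.
have jm : j = i by lia.
by rewrite jm in xj; lra.
Qed.

End Circle.

(** * Chains that produce a unit interval *)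

Section Chains.
Variables (R : realType) (K : set R).
Hypothesis KD : forall x (m : int), K x -> K (x + m%:~R).
Implicit Types (a b c d x y t u v : R) (I : R * R) (p : R -> int).

(** At the left end [u] of [I], the maximality of the value at 0 after the
    addition leaves no room for [p], while monotonicity forces [p = 1] between
    0 and [u]. *)
Lemma addable_right p I : is_pyramid K p -> p 0 = 1 -> addable K p I ->
  0 < I.1 -> forall x, 0 <= x -> p x = (x < I.1)%R%:R.
Proof.
case: I => u v pyr p0 [[/= _ _ uv] pyrI] u0 x x0.
have pu : p u = 0.
  have := pyr_max pyrI u; rewrite itv_in // itv_before // p0.
  have := pyr_ge0 pyr u; lia.
have [xu|ux] := ltP x u.
  have := pyr_decr pyrI x0 (ltW xu).
  rewrite (@itv_in _ u v u) // itv_before // pu.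
  have := pyr_max pyr x; rewrite p0 /=; lia.
have := pyr_decr pyr (ltW u0) ux; have := pyr_ge0 pyr x; rewrite pu /=; lia.
Qed.

Lemma addable_left p I : is_pyramid K p -> p 0 = 1 -> addable K p I ->
  I.2 <= 0 -> forall x, x <= 0 -> p x = (I.2 <= x)%R%:R.
Proof.
case: I => u v pyr p0 [[/= _ _ uv] pyrI] v0 x x0.
have [vx|xv] := leP v x.
  have := pyr_incr pyrI (ltW (lt_le_trans uv vx)) x0.
  rewrite (@itv_in _ u v u) // itv_after //.
  have := pyr_ge0 pyr u; have := pyr_max pyr x; rewrite p0 /=; lia.
have := pyr_max pyrI (Num.max u x).
rewrite itv_in; last 2 first.
- by rewrite le_max lexx.
- by rewrite gt_max uv.
rewrite itv_after // p0.
have xm : x <= Num.max u x by rewrite le_max lexx orbT.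
have m0 : Num.max u x <= 0 by rewrite ge_max x0 andbT; lra.
have := pyr_incr pyr xm m0; have := pyr_ge0 pyr x; rewrite /=; lia.
Qed.

Lemma itv_avoids0 I : I.1 < I.2 -> \1_(interval_set I) 0 = (0 : int) ->
  0 < I.1 \/ I.2 <= 0.
Proof.
case: I => u v /= uv; have [?|u0] := ltP 0 u; first by left.
have [v0|] := ltP 0 v; last by right.
by rewrite itv_in.
Qed.

Lemma addable_lt p I : addable K p I -> I.1 < I.2.
Proof. by case=> [[]]. Qed.

Section Fill.
Variables (p : R -> int) (a : R).
Hypotheses (pyr : is_pyramid K p) (p0 : p 0 = 1).
Hypotheses (a0 : a <= 0) (a1 : 0 < a + 1).

Lemma fill_right u v : addable K p (u, v) -> 0 < u ->
  (forall x, p x + \1_(interval_set (u, v)) x =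
             \1_(interval_set (a, a + 1)) x) ->
  v = a + 1 /\ p = \1_(interval_set (a, u)).
Proof.
move=> addI u0 tot; have uv : u < v := addable_lt addI.
have pE : p = \1_(interval_set (a, u)).
  apply/funext => x; have [x0|x0] := leP 0 x.
    by rewrite (addable_right pyr p0 addI u0 x0) indic_itvE /= (le_trans a0 x0).
  have := tot x; rewrite (itv_before v (lt_trans x0 u0)) addr0 => ->.
  by rewrite !indic_itvE /= (lt_trans x0 a1) (lt_trans x0 u0).
split=> //; apply: (proj2 (@indic_itv_inj _ a v a (a + 1) _ _ _)).
- exact: le_lt_trans a0 (lt_trans u0 uv).
- exact: le_lt_trans a0 a1.
move=> x; rewrite -tot pE indic_itv_cat //; last exact: ltW.
exact: ltW (le_lt_trans a0 u0).
Qed.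

Lemma fill_left u v : addable K p (u, v) -> v <= 0 ->
  (forall x, p x + \1_(interval_set (u, v)) x =
             \1_(interval_set (a, a + 1)) x) ->
  u = a /\ p = \1_(interval_set (v, a + 1)).
Proof.
move=> addI v0 tot; have uv : u < v := addable_lt addI.
have pE : p = \1_(interval_set (v, a + 1)).
  apply/funext => x; have [x0|x0] := leP x 0.
    rewrite (addable_left pyr p0 addI v0 x0) indic_itvE /=.
    by rewrite (le_lt_trans x0 a1) andbT.
  have := tot x; rewrite (itv_after u (le_trans v0 (ltW x0))) addr0 => ->.
  by rewrite !indic_itvE /= (le_trans a0 (ltW x0)) (le_trans v0 (ltW x0)).
split=> //; apply: (proj1 (@indic_itv_inj _ u (a + 1) a (a + 1) _ _ _)).
- exact: lt_trans uv (le_lt_trans v0 a1).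
- exact: le_lt_trans a0 a1.
move=> x; have va1 := le_trans v0 (ltW a1).
by rewrite -tot pE -(indic_itv_cat x (ltW uv) va1) addrC.
Qed.

Lemma fill_both u v u' v' : addable K p (u, v) -> addable K p (u', v') ->
  v <= 0 -> 0 < u' ->
  (forall x, p x + (\1_(interval_set (u, v)) x + \1_(interval_set (u', v')) x) =
             \1_(interval_set (a, a + 1)) x) ->
  u = a /\ v' = a + 1.
Proof.
move=> addI addI' v0 u'0 tot.
have uv : u < v := addable_lt addI; have uv' : u' < v' := addable_lt addI'.
have vu' : v <= u' := le_trans v0 (ltW u'0).
have pE x : p x = \1_(interval_set (v, u')) x.
  rewrite indic_itvE /=; have [x0|x0] := leP x 0.
    by rewrite (addable_left pyr p0 addI v0 x0) (le_lt_trans x0 u'0) andbT.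
  rewrite (addable_right pyr p0 addI' u'0 (ltW x0)) /=.
  by rewrite (le_trans v0 (ltW x0)).
apply: indic_itv_inj => [||x].
- exact: lt_trans uv (le_lt_trans vu' uv').
- exact: le_lt_trans a0 a1.
have uu' := le_trans (ltW uv) vu'.
rewrite -tot pE -(indic_itv_cat x uu' (ltW uv')).
by rewrite -(indic_itv_cat x (ltW uv) vu') -addrA [LHS]addrCA.
Qed.

End Fill.

(** The two intervals which complete [[c, d[] to an interval of length one. *)
Definition slot_chain c d (s : seq (R * R)) : Prop :=
  s = [:: (d, c + 1)] \/ s = [:: (d - 1, c)].

Lemma unit_chainP p J s a : is_pyramid K p -> J <> [set: circle R] ->
  F_chains K p J s ->
  (forall x, p x + \sum_(I <- s) \1_(interval_set I) x =
             \1_(interval_set (a, a + 1)) x) ->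
  exists c d, [/\ K c, K d, [/\ c <= 0, 0 < d & d < c + 1],
    p = \1_(interval_set (c, d)) & J = arc_of (d, c + 1) /\ slot_chain c d s].
Proof.
move=> pyr JT [add srt [s0 arr _ union]] tot.
have lt_ends I : I \in s -> I.1 < I.2 by move=> /add/addable_lt.
have sum_ge0 (r : seq (R * R)) x :
    0 <= \sum_(I <- r) \1_(interval_set I) x :> int.
  by apply: sumr_ge0 => I _; rewrite indic_itvE.
have : p 0 = 0 \/ p 0 = 1.
  have := tot 0; have := pyr_ge0 pyr 0; have := sum_ge0 s 0.
  by rewrite indic_itvE; case: (_ && _) => /=; lia.
have tot0 := tot 0; case=> p0.
  (* If p = 0, each interval of s contains 0; there is only one, and its arc *)
  (* is the whole circle. *)
  have pz x : p x = 0.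
    by have := pyr_ge0 pyr x; have := pyr_max pyr x; rewrite p0; lia.
  have contains0 I : I \in s -> \1_(interval_set I) 0 = (1 : int).
    case: I => u v Is; have uv := lt_ends _ Is; have [_ pyrI] := add _ Is.
    have := pyr_max pyrI u; rewrite !pz itv_in //= !indic_itvE /=.
    by case: (_ && _).
  case: s {add srt arr} s0 union tot lt_ends tot0 contains0 => // -[u v] s _.
  move=> union tot lt_ends tot0 contains0.
  have snil : s = [::].
    case: s tot0 contains0 {union tot lt_ends} => // I s tot0 contains0.
    move: tot0; rewrite !big_cons p0 (contains0 (u, v)) ?(contains0 I);
      rewrite ?inE ?eqxx ?orbT // indic_itvE.
    by have := sum_ge0 s 0; case: (_ && _) => /=; lia.
  case: JT; rewrite -union snil bigcup_seq big_seq1.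
  have [-> ->] : u = a /\ v = a + 1.
    apply: indic_itv_inj => [||x]; last by rewrite -tot pz snil big_seq1 add0r.
    - by apply: (lt_ends (u, v)); rewrite inE eqxx.
    - by rewrite ltrDl.
  exact: arc_of_full.
have [a0 a1] : a <= 0 /\ 0 < a + 1.
  apply/andP; have := sum_ge0 s 0; move: tot0; rewrite p0 indic_itvE /=.
  by case: (_ && _) => //=; lia.
have avoids I : I \in s -> 0 < I.1 \/ I.2 <= 0.
  move=> Is; apply: itv_avoids0; first exact: lt_ends.
  have := sum_ge0 (rem I s) 0; move: tot0; rewrite (big_rem I Is) p0.
  set S := \sum_(_ <- _) _; rewrite !indic_itvE.
  by case: (_ && _); case: (_ && _) => /=; lia.
have right I (Is : I \in s) := addable_right pyr p0 (add I Is).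
have left I (Is : I \in s) := addable_left pyr p0 (add I Is).
(* On either side of 0 the position of an addable interval is determined by *)
(* p, hence s has at most one interval on each side. *)
have two_right I I' : I \in s -> I' \in s -> 0 < I.1 -> ~ interval_lt I I'.
  move=> Is I's I0; rewrite /interval_lt => II'.
  have lI := lt_ends _ Is; have := right I Is I0 I.1 (ltW I0).
  rewrite (right I' I's _ I.1 (ltW I0)) ?ltxx; last by lra.
  by rewrite (lt_trans lI II').
have two_left I I' : I \in s -> I' \in s -> I'.2 <= 0 -> ~ interval_lt I I'.
  move=> Is I's I0; rewrite /interval_lt => II'.
  have lI := lt_ends _ I's; have v0 : I.2 <= 0 by lra.
  have := left I Is v0 I.2 v0.
  by rewrite (left I' I's I0 I.2 v0) lexx leNgt (lt_trans II' lI).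
case: s s0 add srt arr union tot lt_ends avoids two_right two_left
  {right left tot0 sum_ge0} => [//|[u v] [|[u' v'] s]] _ add srt arr union tot
  lt_ends avoids two_right two_left.
- have inI : (u, v) \in [:: (u, v)] by rewrite inE.
  have addI := add _ inI; have [[/= Ku Kv _] _] := addI.
  rewrite bigcup_seq big_seq1 in union.
  have {}tot x : p x + \1_(interval_set (u, v)) x =
                 \1_(interval_set (a, a + 1)) x.
    by rewrite -tot big_seq1.
  have uv : u < v := addable_lt addI.
  have [/= u0|/= v0] := avoids _ inI.
    have [va pE] := fill_right pyr p0 a0 a1 addI u0 tot.
    exists a, u; split=> //.
    + by have := KD (-1) Kv; rewrite va rmorphN1 addrK.
    + by rewrite -va.
    + by split; [rewrite -union va|left; rewrite va].
  have [ua pE] := fill_left pyr p0 a0 a1 addI v0 tot.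
  exists v, (a + 1); split=> //; first by rewrite -ua; exact: (KD 1).
    by split=> //; rewrite ltrD2r -ua.
  split; last by right; rewrite addrK ua.
  by rewrite -union ua -(arc_of_tau 1).
have inI : (u, v) \in [:: (u, v), (u', v') & s] by rewrite inE eqxx.
have inI' : (u', v') \in [:: (u, v), (u', v') & s].
  by rewrite !inE eqxx orbT.
have v0 : v <= 0.
  case: (avoids _ inI) => // u0; case: (two_right _ _ inI inI' u0).
  by case/andP: srt.
have u0 : 0 < u'.
  case: (avoids _ inI') => // v'0; case: (two_left _ _ inI inI' v'0).
  by case/andP: srt.
have snil : s = [::].
  case: s srt two_right inI' {add union arr tot lt_ends avoids two_left inI} =>
    // I s /= /and3P[_ I'I _] two_right inI'.
  by case: (two_right (u', v') I); rewrite ?inE ?eqxx ?orbT.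
have [ua va] : u = a /\ v' = a + 1.
  apply: (fill_both pyr p0 a0 a1 (add _ inI) (add _ inI')) => // x.
  by rewrite -tot snil big_cons big_seq1.
(* Then the arcs of [a, v[ and [u', a + 1[ would have to be adjacent. *)
move: arr => /= /andP[/asboolP]; rewrite ua va => arr _.
have := lt_ends _ inI; have := lt_ends _ inI'; rewrite /= ua va => uv' uv.
by case: (not_arrow_gap uv (le_lt_trans v0 u0) uv' arr).
Qed.

End Chains.

(** * The coefficients of the two completions *)

Section Coefficients.
Variables (R : realType) (K : set R).
Hypothesis KD : forall x (m : int), K x -> K (x + m%:~R).

Lemma nI_far (c d : R) (I : R * R) : 0 < d -> d < I.1 ->
  nI K \1_(interval_set (c, d)) I = 0.
Proof.
case: I => u v d0 /= du; rewrite /nI.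
case: asboolP => [[[/= _ _ uv] pyr]|_].
  have := pyr_decr pyr (ltW d0) (ltW du).
  rewrite (itv_after c (ltW du)) (itv_after c (lexx d)) (itv_before v du).
  by rewrite itv_in.
case: asboolP => [[[/= _ _ uv] pyr]|//].
by have := pyr_ge0 pyr u; rewrite (itv_after c (ltW du)) itv_in.
Qed.

Variables c d : R.
Hypotheses (Kc : K c) (Kd : K d) (c0 : c <= 0) (d0 : 0 < d) (dc : d < c + 1).
Let p : R -> int := \1_(interval_set (c, d)).

Let cd : c < d. Proof. exact: le_lt_trans c0 d0. Qed.
Let Kc1 : K (c + 1). Proof. exact: (KD 1). Qed.
Let Kd1 : K (d - 1). Proof. by have := KD (-1) Kd; rewrite rmorphN1. Qed.
Let dc1 : d - 1 < c. Proof. by rewrite ltrBlDr. Qed.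

Lemma join_slot_right : (fun x => p x + \1_(interval_set (d, c + 1)) x) =
  \1_(interval_set (c, c + 1)).
Proof. by apply/funext => x; apply: indic_itv_cat; exact: ltW. Qed.

Lemma join_slot_left : (fun x => p x + \1_(interval_set (d - 1, c)) x) =
  \1_(interval_set (d - 1, d)).
Proof. by apply/funext => x; rewrite addrC indic_itv_cat //; exact: ltW. Qed.

Lemma addable_slot_right : addable K p (d, c + 1).
Proof.
split; first by split.
rewrite join_slot_right.
by apply: itv_is_pyramid => //; exact: lt_trans d0 dc.
Qed.

Lemma addable_slot_left : addable K p (d - 1, c).
Proof.
split; first by split.
rewrite join_slot_left.
by apply: itv_is_pyramid => //; exact: ltW (lt_le_trans dc1 c0).
Qed.

Lemma n_gt_slot_right : n_gt K p (d, c + 1) = 0.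
Proof.
apply: fsbig1 => m /= m1; apply: nI_far => //=.
by rewrite ltrDl ltr0z; lia.
Qed.

(** Only the first translate of [[d - 1, c[] contributes: it is the right
    completion. *)
Lemma n_gt_slot_left : n_gt K p (d - 1, c) = 1.
Proof.
rewrite /n_gt -(@fsbig_widen _ _ _ _ [set 1]).
- rewrite fsbig_set1 /tau /= subrK /nI asboolT //.
  exact: addable_slot_right.
- by move=> _ ->.
- move=> m [/= m1 m_neq1]; apply: nI_far => //=.
  have : (1 + 1 : R) <= m%:~R.
    by rewrite -[1]/(1%:~R) -intrD ler_int; lia.
  by lra.
Qed.

Lemma eform_slot_right : line_eform \1_(interval_set (d, c + 1)) p = 0.
Proof.
rewrite line_eform_itv; apply: fsbig1 => x _.
have [dx|] := ltP d x; last by rewrite mul0r.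
by rewrite [x < d]ltNge (ltW dx) !andbF subr0 mulr0.
Qed.

(** The only jump of [p] inside []d - 1, c]] is the one at [c]. *)
Lemma eform_slot_left : line_eform \1_(interval_set (d - 1, c)) p = -1.
Proof.
rewrite line_eform_itv -(@fsbig_widen _ _ _ _ [set c]).
- by rewrite fsbig_set1 /= ltxx cd lexx dc1.
- by [].
- move=> x [_ /= /eqP xc].
  have [xc'|] := leP x c; last by rewrite andbF mul0r.
  have {xc xc'}xc : x < c by rewrite lt_neqAle xc.
  by rewrite /= [c <= x]leNgt xc subr0 mulr0.
Qed.

Lemma slot_chains : F_chains K p (arc_of (d, c + 1)) [:: (d, c + 1)] /\
  F_chains K p (arc_of (d, c + 1)) [:: (d - 1, c)].
Proof.
split; split=> //.
- by move=> I; rewrite inE => /eqP ->; exact: addable_slot_right.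
- by split=> //; rewrite bigcup_seq big_seq1.
- by move=> I; rewrite inE => /eqP ->; exact: addable_slot_left.
- by split=> //; rewrite bigcup_seq big_seq1 -(arc_of_tau 1) /tau /= subrK.
Qed.

End Coefficients.

(** * The linear form that counts unit intervals *)

Section UnitForm.
Variables (R : realType) (K : set R).
Hypothesis KD : forall x (m : int), K x -> K (x + m%:~R).
Implicit Types (p : pyramid K) (J : set (circle R)).

Lemma upsilon_half_neq0 : upsilon_half != 0.
Proof. by rewrite /upsilon_half tofrac_eq0 polyX_eq0. Qed.

Lemma upsilon_neq0 : upsilon != 0.
Proof. by rewrite expf_neq0 // upsilon_half_neq0. Qed.

Lemma big_seq_two (I : eqType) (V : zmodType) (r : seq I) (F : I -> V) i j :
  uniq r -> i \in r -> j \in r -> i != j ->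
  (forall k, k \in r -> k != i -> k != j -> F k = 0) ->
  \sum_(k <- r) F k = F i + F j.
Proof.
move=> ur ir jr ij F0; rewrite (bigD1_seq i) //=; congr (_ + _).
rewrite big_mkcond (bigD1_seq j) //= eq_sym ij big_seq_cond big1 ?addr0 //.
by move=> k /andP[kr kj]; case: ifP => // ki; exact: F0.
Qed.

Definition is_unit_itv (f : R -> int) : Prop :=
  exists a, f = \1_(interval_set (a, a + 1)).

Definition unit_form (w : Fock K) : qfield :=
  mmap idfun (fun p => (`[< is_unit_itv (val p) >])%:R) w.

Lemma unit_formD : {morph unit_form : w w' / w + w'}.
Proof. exact: mmapD. Qed.

Lemma unit_form_sum (T : Type) (r : seq T) (F : T -> Fock K) :
  unit_form (\sum_(i <- r) F i) = \sum_(i <- r) unit_form (F i).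
Proof. exact: raddf_sum. Qed.

Lemma unit_form0 : unit_form 0 = 0.
Proof. exact: mmap0. Qed.

Lemma unit_formZ (k : qfield) w : unit_form (k *: w) = k * unit_form w.
Proof.
rewrite /unit_form (mmapEw (d := msupp w)) ?msuppZ_le //.
rewrite mmapE mulr_sumr; apply: eq_bigr => p _.
by rewrite mcoeffZ mulrA.
Qed.

Lemma unit_form_ket p : unit_form (ket p) = (`[< is_unit_itv (val p) >])%:R.
Proof. by rewrite /unit_form mmapU mul1r. Qed.

Lemma unit_form_ket_fun (f : R -> int) : is_pyramid K f -> is_unit_itv f ->
  unit_form (ket_fun K f) = 1.
Proof.
move=> pf uf; rewrite /ket_fun.
case: insubP => [q _ qf|]; last by rewrite asboolT.
by rewrite unit_form_ket qf asboolT.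
Qed.

Lemma unit_form_ket_fun_neq0 (f : R -> int) :
  unit_form (ket_fun K f) != 0 -> is_unit_itv f.
Proof.
rewrite /ket_fun; case: insubP => [p _ <-|_]; last by rewrite unit_form0 eqxx.
by rewrite unit_form_ket; case: asboolP => //; rewrite eqxx.
Qed.

(** Once some chain contributes, [p] and [J] are those of [unit_chainP], and
    the two completions are the only chains that contribute. *)
Lemma unit_form_F_op J p : J <> [set: circle R] -> unit_form (F_op J p) = 0.
Proof.
move=> JT; rewrite /F_op; set term := fun s : seq (R * R) => _ *: _.
set S := finite_support _ _ _; rewrite unit_form_sum.
have [all0|] := pselect (forall s, s \in S -> unit_form (term s) = 0).
  by rewrite big_seq big1.
move=> /existsNP[s /not_implyP[sS nz]].
have inS r : r \in S -> F_chains K (val p) J r.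
  rewrite /S; have [fin|nfin] := pselect
    (finite_set (F_chains K (val p) J `&` term @^-1` [set~ 0])).
    by rewrite in_finite_support // inE => -[].
  by rewrite no_finite_support.
(* Since S contains s, it is the actual support of term and not the empty *)
(* list that stands for an infinite one; so contributing chains lie in S. *)
have memS r : F_chains K (val p) J r -> unit_form (term r) != 0 -> r \in S.
  have fin : finite_set (F_chains K (val p) J `&` term @^-1` [set~ 0]).
    by apply: contrapT => nfin; move: sS; rewrite /S no_finite_support.
  move=> rF nzr; rewrite /S in_finite_support // inE; split=> // tr0.
  by move: nzr; rewrite tr0 unit_form0 eqxx.
have pyr : is_pyramid K (val p) := asboolW (svalP p).
have chain_slot r : r \in S -> unit_form (term r) <> 0 ->
    exists c d, [/\ K c, K d, [/\ c <= 0, 0 < d & d < c + 1],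
      val p = \1_(interval_set (c, d)) &
      J = arc_of (d, c + 1) /\ slot_chain c d r].
  move=> rS nzr.
  have : is_unit_itv
      (fun x => val p x + \sum_(I <- r) \1_(interval_set I) x).
    apply: unit_form_ket_fun_neq0; apply/eqP => kr0; apply: nzr.
    by rewrite /term unit_formZ kr0 mulr0.
  move=> [a ra]; apply: (unit_chainP KD pyr JT (inS _ rS) (a := a)) => x.
  by rewrite -ra.
have [c [d [Kc Kd [c0 d0 dc] pcd [Jcd _]]]] := chain_slot s sS nz.
have cd : c < d by lra.
have [F1 F2] := slot_chains KD Kc Kd c0 d0 dc.
have slot_add u v :
    (fun x => val p x + \sum_(I <- [:: (u, v)]) \1_(interval_set I) x) =
    (fun x => \1_(interval_set (c, d)) x + \1_(interval_set (u, v)) x).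
  by apply/funext => x; rewrite big_seq1 pcd.
have t1 : unit_form (term [:: (d, c + 1)]) = upsilon_half.
  rewrite /term unit_formZ slot_add !big_seq1 pcd.
  rewrite n_gt_slot_right // eform_slot_right //.
  rewrite unit_form_ket_fun ?expr1 ?expr0 ?expr0z ?mulr1 //.
    by have [] := addable_slot_right KD Kc Kd c0 d0 dc.
  by exists c; exact: join_slot_right.
have t2 : unit_form (term [:: (d - 1, c)]) = - upsilon_half.
  rewrite /term unit_formZ slot_add !big_seq1 pcd.
  rewrite n_gt_slot_left // eform_slot_left //.
  rewrite unit_form_ket_fun ?expr1 ?expr0 ?exprN1 ?expr1z ?mulr1 //.
  - by rewrite -mulrA invrN mulrN divff ?mulrN1 // upsilon_neq0.
  - by have [] := addable_slot_left KD Kc Kd c0 d0 dc.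
  - by exists (d - 1); rewrite subrK; exact: join_slot_left.
have v0 := upsilon_half_neq0.
have s1S : [:: (d, c + 1)] \in S by apply: memS; [rewrite pcd Jcd|rewrite t1].
have s2S : [:: (d - 1, c)] \in S.
  by apply: memS; [rewrite pcd Jcd|rewrite t2 oppr_eq0].
have s12 : [:: (d, c + 1)] != [:: (d - 1, c)].
  by apply/eqP => -[e _]; move: e => /eqP; rewrite gt_eqF // ltrBlDr ltrDl.
have uS : uniq S by exact: finite_support_uniq.
have sum2 := @big_seq_two _ _ S (fun r => unit_form (term r)) _ _
  uS s1S s2S s12.
apply: (etrans (sum2 _)); last first.
  by apply: (etrans (congr2 +%R t1 t2)); exact: subrr.
move=> r rS r1 r2.
apply: contrapT => nzr.
have [c' [d' [_ _ [c'0 d'0 d'c'] pcd' [_ slot]]]] := chain_slot r rS nzr.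
have [cc dd] : c = c' /\ d = d'.
  by apply: indic_itv_inj; [lra|lra|move=> x; rewrite -pcd -pcd'].
by case: slot => rE; [move: r1|move: r2]; rewrite rE -cc -dd eqxx.
Qed.

End UnitForm.

(** * Cutting the circle *)

Section Action.
Variables (R : realType) (K : set R) (act : Uq K -> Fock K -> Fock K).
Hypothesis KD : forall (t : R) (m : int), K t -> K (t + m%:~R).
Hypothesis hact : is_Fock_action act.
Implicit Types (a b t : R) (x y : expr K) (w : Fock K).
Implicit Types (J : strict_arc K) (k : qfield).

(** The action is studied on expressions rather than on their classes, because
    [appE] computes it by recursion on the syntax of [x]. *)
Definition app x w : Fock K := act (Ucls x) w.

Lemma appD x w w' : app x (w + w') = app x w + app x w'.
Proof. by have := act_linear hact (Ucls x) 1 w w'; rewrite !scale1r. Qed.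

Lemma app0 x : app x 0 = 0.
Proof. by apply: (addrI (app x 0)); rewrite -appD !addr0. Qed.

Lemma appZ x k w : app x (k *: w) = k *: app x w.
Proof. exact: (GRing.scalable_linear (act_linear hact (Ucls x))). Qed.

Lemma app_Add x y w : app (Add x y) w = app x w + app y w.
Proof.
have : act (1 *: Ucls x + Ucls y) w = 1 *: app x w + app y w :=
  act_linearl hact w 1 (Ucls x) (Ucls y).
by rewrite !scale1r => <-; rewrite /app -UaddE.
Qed.

Lemma app_Zero w : app (Zero K) w = 0.
Proof.
apply: (addrI (app (Zero K) w)); rewrite -app_Add addr0.
by congr (act _ w); apply/Ucls_eq; exact: cong_add0.
Qed.

Lemma app_Scale k x w : app (Scale k x) w = k *: app x w.
Proof.
have : act (k *: Ucls x + Ucls (Zero K)) w = k *: app x w + app (Zero K) w :=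
  act_linearl hact w k (Ucls x) (Ucls (Zero K)).
rewrite app_Zero (addr0 (k *: app x w)) => <-; congr (act _ _).
by rewrite -UscaleE -[LHS](addr0 (k *: Ucls x)).
Qed.

Lemma app_Opp x w : app (Opp x) w = - app x w.
Proof.
apply: (addIr (app x w)); rewrite addNr -app_Add -(app_Zero w).
by congr (act _ w); apply/Ucls_eq; exact: cong_addN.
Qed.

Lemma app_One w : app (One K) w = w.
Proof. exact: act_one. Qed.

Lemma app_Mul x y w : app (Mul x y) w = app x (app y w).
Proof. by rewrite /app -(act_mul hact) -UmulE. Qed.

Lemma app_rel x y w : Urel x y -> app x w = app y w.
Proof. by move=> xy; congr (act _ w); apply/Ucls_eq; exact: cong_rel. Qed.

Definition appE := (app_Add, app_Opp, app_Mul, app_Scale, app_One, app_Zero).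

Lemma strict_arc_inj J J' : arc_set J = arc_set J' -> J = J'.
Proof.
case: J => -[A hA] nA; case: J' => -[B hB] nB /= AB; move: AB hB nB => <- hB nB.
by have -> : hA = hB by []; have -> : nA = nB by [].
Qed.

(** The finite set [S] of cut points is read modulo the integers. *)
Definition cut (S : seq R) (t : R) : Prop :=
  K t /\ exists2 s, s \in S & exists m : int, t = s + m%:~R.

Definition strict_itv a b : Prop := [/\ K a, K b, a < b & b < a + 1].

Lemma strict_arcP J : exists a b, strict_itv a b /\ arc_set J = arc_of (a, b).
Proof.
case: J => -[A [[a b] [[/= Ka Kb ab] ba AE]]] /= nT.
exists a, b; split=> //; split=> //.
rewrite lt_neqAle -lerBlDl ba andbT; apply/eqP => b1; apply: nT.
by rewrite AE b1 arc_of_full.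
Qed.

Lemma strict_arc_of a b : strict_itv a b -> exists J, arc_set J = arc_of (a, b).
Proof.
move=> [Ka Kb ab ba].
have arcP : is_arc K (arc_of (a, b)) by exists (a, b); split=> //=; lra.
have nT : arc_set (CircleArc arcP) <> [set: circle R] by exact: arc_of_neqT.
by exists (StrictArc nT).
Qed.

Section Cuts.
Variable S : seq R.

(** The pieces of the circle cut at [S]; arcs are compared through their lifts,
    which are determined only up to integer translation. *)
Definition elementary J : Prop := exists a b,
  [/\ strict_itv a b, cut S a, cut S b,
      (forall t, cut S t -> a < t -> t < b -> False) &
      arc_set J = arc_of (a, b)].

Lemma cut_shift t (m : int) : cut S t -> cut S (t + m%:~R).
Proof.
move=> [Kt [s sS [n tE]]]; split; first exact: KD.
exists s => //; exists (n + m); rewrite tE.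
by rewrite rmorphD /= addrA.
Qed.

Lemma elementary_disjoint J J' : elementary J -> elementary J' ->
  J = J' \/ J `&` J' = set0.
Proof.
move=> [a [b [_ ca cb nab JE]]] [a' [b' [_ ca' cb' nab' JE']]].
have [|/set0P[z []]] := eqVneq (arc_set J `&` arc_set J') set0.
  by right.
have [y ->] := circle_projP z; rewrite JE JE'.
move=> /arc_ofP[m /= ym] /arc_ofP[n /= yn].
left; apply: strict_arc_inj; rewrite JE JE'.
have ca'' := cut_shift (m - n) ca'; have cb'' := cut_shift (m - n) cb'.
have ca2 := cut_shift (n - m) ca; have cb2 := cut_shift (n - m) cb.
rewrite !rmorphB /= in ca'' cb'' ca2 cb2.
rewrite -(arc_of_tau (n - m)) /tau /= rmorphB /=.
have -> : a + (n%:~R - m%:~R) = a'.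
  apply/eqP; rewrite eq_le !leNgt; apply/andP; split; apply/negP => lt_aa.
    by apply: (nab' _ ca2); lra.
  by apply: (nab _ ca''); lra.
have -> // : b + (n%:~R - m%:~R) = b'.
apply/eqP; rewrite eq_le !leNgt; apply/andP; split; apply/negP => lt_bb.
  by apply: (nab _ cb''); lra.
by apply: (nab' _ cb2); lra.
Qed.

(** An inductive span, so that stability under a generator is proved by moving
    the generator through one letter at a time. *)
Inductive Fspan : Fock K -> Prop :=
| Fspan_vac : Fspan (ket (zero_pyramid K))
| Fspan_F J w : elementary J -> Fspan w -> Fspan (app (gF J) w)
| Fspan_add w w' : Fspan w -> Fspan w' -> Fspan (w + w')
| Fspan_scale k w : Fspan w -> Fspan (k *: w).

Lemma Fspan_opp w : Fspan w -> Fspan (- w).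
Proof. by rewrite -scaleN1r; exact: Fspan_scale. Qed.

Lemma app_KKinv (I : circle_arc K) w : app (gK I) (app (gKinv I) w) = w.
Proof. by rewrite -app_Mul (app_rel _ (rel_KKinv I)) app_One. Qed.

Lemma app_KinvK (I : circle_arc K) w : app (gKinv I) (app (gK I) w) = w.
Proof. by rewrite -app_Mul (app_rel _ (rel_KinvK I)) app_One. Qed.

Lemma app_KF (I : circle_arc K) J : exists2 k, k != 0 &
  forall w, app (gK I) (app (gF J) w) = k *: app (gF J) (app (gK I) w).
Proof.
exists (upsilon ^ (- circle_sform I J)).
  by rewrite expfz_neq0 // upsilon_neq0.
move=> w; have := app_rel (app (gK I) w) (rel_KF I J).
by rewrite !appE app_KinvK.
Qed.

Lemma app_K_vac (I : circle_arc K) : exists2 k, k != 0 &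
  app (gK I) (ket (zero_pyramid K)) = k *: ket (zero_pyramid K).
Proof.
exists (upsilon ^ nbar_arc K (val (zero_pyramid K)) I).
  by rewrite expfz_neq0 // upsilon_neq0.
exact: act_K.
Qed.

Lemma Fspan_K (I : circle_arc K) w : Fspan w -> Fspan (app (gK I) w).
Proof.
elim=> {w} [|J w eJ _ IH|w w' _ IH _ IH'|k w _ IH].
- by have [k _ ->] := app_K_vac I; apply/Fspan_scale/Fspan_vac.
- by have [k _ ->] := app_KF I J; apply/Fspan_scale/Fspan_F.
- by rewrite appD; exact: Fspan_add.
- by rewrite appZ; exact: Fspan_scale.
Qed.

Lemma Fspan_Kinv (I : circle_arc K) w : Fspan w -> Fspan (app (gKinv I) w).
Proof.
elim=> {w} [|J w eJ _ IH|w w' _ IH _ IH'|k w _ IH].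
- have [k k0 Kvac] := app_K_vac I.
  rewrite -[ket _](scalerK k0) -Kvac appZ app_KinvK.
  by apply/Fspan_scale/Fspan_vac.
- have [k k0 KF] := app_KF I J.
  rewrite -[w](app_KKinv I) -[X in app _ X](scalerK k0) -KF appZ app_KinvK.
  exact/Fspan_scale/Fspan_F.
- by rewrite appD; exact: Fspan_add.
- by rewrite appZ; exact: Fspan_scale.
Qed.

Lemma app_E_vac J : app (gE J) (ket (zero_pyramid K)) = 0.
Proof.
rewrite /app act_E // /E_op fsbig1 // => s [rem _ [s0 _ _ _]].
case: s s0 rem => // -[u v] s _ /(_ (u, v)); rewrite inE eqxx => /(_ isT).
move=> [[/= _ _ uv] pyr].
by have := pyr_ge0 pyr u; rewrite itv_in.
Qed.

(** Only here the commutators of the [E]'s and [F]'s enter; elementary arcs are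
    in the two cases which the defining relations cover. *)
Lemma Fspan_E_elementary J w : elementary J -> Fspan w -> Fspan (app (gE J) w).
Proof.
move=> eJ; elim=> {w} [|J' w eJ' Sw IH|w w' _ IH _ IH'|k w _ IH].
- rewrite app_E_vac -(scale0r (ket (zero_pyramid K))).
  exact/Fspan_scale/Fspan_vac.
- have [<-|dis] := elementary_disjoint eJ eJ'.
    have := app_rel w (rel_EF J); rewrite !appE => /eqP.
    rewrite subr_eq => /eqP ->; apply: Fspan_add; last exact: Fspan_F.
    apply/Fspan_scale/Fspan_add; first exact: Fspan_K.
    exact/Fspan_opp/Fspan_Kinv.
  have := app_rel w (rel_EF_disjoint dis); rewrite !appE => /eqP.
  by rewrite subr_eq0 => /eqP ->; exact: Fspan_F.
- by rewrite appD; exact: Fspan_add.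
- by rewrite appZ; exact: Fspan_scale.
Qed.

Definition inner_cuts a b : nat :=
  count (fun s => `[< exists m : int, a < s + m%:~R /\ s + m%:~R < b >]) S.

(** An interval of length less than one contains at most one integer translate
    of the cut point [t], so a subinterval that misses [t] loses a class. *)
Lemma inner_cuts_lt a b a' b' t : a <= a' -> b' <= b -> b < a + 1 ->
  cut S t -> a < t -> t < b -> (t <= a' \/ b' <= t) ->
  (inner_cuts a' b' < inner_cuts a b)%N.
Proof.
move=> aa bb ba [_ [s sS [m tE]]] at_ tb t_out.
rewrite /inner_cuts.
set Q := fun s => `[< exists m : int, a' < s + m%:~R /\ s + m%:~R < b' >].
set P := fun s => `[< exists m : int, a < s + m%:~R /\ s + m%:~R < b >].
have sub : subpred Q P.
  by move=> r /asboolP[n [h1 h2]]; apply/asboolP; exists n; split; lra.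
have Ps : P s by apply/asboolP; exists m; rewrite -tE.
have Qs : ~~ Q s.
  apply/negP => /asboolP[n [h1 h2]].
  have nm : n - m = 0 by apply: (@int_lt1 R); rewrite rmorphB /=; lra.
  have nmE : n = m by apply/eqP; rewrite -subr_eq0 nm.
  by rewrite nmE -tE in h1 h2; case: t_out; lra.
move: sS; elim: S => // r r' IH; rewrite inE /= => /orP[/eqP <-|/IH{}IH].
  by rewrite Ps (negbTE Qs) ltnS; exact: sub_count.
have := sub r; case: (Q r) => [/(_ isT) ->|_]; first by rewrite ltn_add2l.
by rewrite add0n (leq_trans IH) // leq_addl.
Qed.

(** By induction on [inner_cuts], splitting an arc at a cut point inside it. *)
Lemma cut_arc_ind (P : strict_arc K -> Prop) :
  (forall J, elementary J -> P J) ->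
  (forall J1 J2 J,
    arrow K J1 J2 -> J1 `|` J2 = J -> P J1 -> P J2 -> P J) ->
  forall J a b, strict_itv a b -> cut S a -> cut S b ->
    arc_set J = arc_of (a, b) -> P J.
Proof.
move=> Pel Psplit J a b; have [n] := ubnP (inner_cuts a b).
elim: n J a b => // n IH J a b lt_n [Ka Kb ab ba] ca cb JE.
have [[t [ct at_ tb]]|nt] :=
  pselect (exists t, [/\ cut S t, a < t & t < b]); last first.
  by apply: Pel; exists a, b; split=> // t ct at_ tb; apply: nt; exists t.
have s1 : strict_itv a t by split=> //; [exact: (proj1 ct)|lra].
have s2 : strict_itv t b by split=> //; [exact: (proj1 ct)|lra].
have [J1 J1E] := strict_arc_of s1; have [J2 J2E] := strict_arc_of s2.
apply: (Psplit J1 J2).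
- by rewrite J1E J2E; apply: arrow_split => //; exact: ltW.
- by rewrite J1E J2E JE arc_of_split.
- apply: (IH J1 a t) => //; apply: leq_trans _ (lt_n : (_ <= n)%N).
  by apply: (inner_cuts_lt (t := t)) => //; [exact: ltW|right].
- apply: (IH J2 t b) => //; apply: leq_trans _ (lt_n : (_ <= n)%N).
  by apply: (inner_cuts_lt (t := t)) => //; [exact: ltW|left].
Qed.

Lemma Fspan_split J1 J2 J (G : strict_arc K -> expr K) (k k' : qfield) :
  (forall w, app (G J) w = k *: app (G J1) (app (G J2) w) +
                           k' *: app (G J2) (app (G J1) w)) ->
  (forall w, Fspan w -> Fspan (app (G J1) w)) ->
  (forall w, Fspan w -> Fspan (app (G J2) w)) ->
  forall w, Fspan w -> Fspan (app (G J) w).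
Proof.
move=> GJ G1 G2 w Sw; rewrite GJ; apply: Fspan_add; apply: Fspan_scale.
  exact/G1/G2.
exact/G2/G1.
Qed.

Lemma Fspan_E J a b w : strict_itv a b -> cut S a -> cut S b ->
  arc_set J = arc_of (a, b) -> Fspan w -> Fspan (app (gE J) w).
Proof.
move=> ab ca cb JE; move: w.
apply: (@cut_arc_ind
  (fun J => forall w, Fspan w -> Fspan (app (gE J) w)) _ _ J a b) => //.
  by move=> {ab ca cb JE}J eJ w; exact: Fspan_E_elementary.
move=> J1 J2 {ab ca cb JE}J arr JU; apply: Fspan_split => w.
by rewrite (app_rel w (rel_E_join arr JU)) !appE -scaleNr.
Qed.

Lemma Fspan_F_arc J a b w : strict_itv a b -> cut S a -> cut S b ->
  arc_set J = arc_of (a, b) -> Fspan w -> Fspan (app (gF J) w).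
Proof.
move=> ab ca cb JE; move: w.
apply: (@cut_arc_ind
  (fun J => forall w, Fspan w -> Fspan (app (gF J) w)) _ _ J a b) => //.
  by move=> {ab ca cb JE}J eJ w; exact: Fspan_F.
move=> J1 J2 {ab ca cb JE}J arr JU F1 F2; apply: Fspan_split F2 F1 => w.
by rewrite (app_rel w (rel_F_join arr JU)) !appE -scaleNr.
Qed.

End Cuts.

Lemma Fspan_arc J : exists S0 : seq R, forall S, {subset S0 <= S} ->
  forall w, Fspan S w -> Fspan S (app (gE J) w) /\ Fspan S (app (gF J) w).
Proof.
have [a [b [ab JE]]] := strict_arcP J; have [Ka Kb _ _] := ab.
exists [:: a; b] => S sub w Sw.
have ca : cut S a.
  split=> //; exists a; first by apply: sub; rewrite inE eqxx.
  by exists 0; rewrite addr0.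
have cb : cut S b.
  split=> //; exists b; first by apply: sub; rewrite !inE eqxx orbT.
  by exists 0; rewrite addr0.
split; first exact: Fspan_E ab ca cb JE Sw.
exact: Fspan_F_arc ab ca cb JE Sw.
Qed.

(** The cut points serve any larger [S], so those of the two factors of a
    product may be merged. *)
Lemma Fspan_expr x : exists S0 : seq R, forall S, {subset S0 <= S} ->
  forall w, Fspan S w -> Fspan S (app x w).
Proof.
elim: x => [g| | |x [S1 H1]|x [S1 H1] y [S2 H2]|x [S1 H1] y [S2 H2]
  |k x [S1 H1]].
- case: g => J.
  + by have [S0 H] := Fspan_arc J; exists S0 => S sub w /(H _ sub) [].
  + by have [S0 H] := Fspan_arc J; exists S0 => S sub w /(H _ sub) [].
  + by exists [::] => S _ w; exact: Fspan_K.
  + by exists [::] => S _ w; exact: Fspan_Kinv.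
- exists [::] => S _ w Sw; rewrite appE -(scale0r w); exact: Fspan_scale.
- by exists [::] => S _ w Sw; rewrite appE.
- by exists S1 => S sub w Sw; rewrite appE; exact/Fspan_opp/H1.
- exists (S1 ++ S2) => S sub w Sw; rewrite appE.
  have sub1 : {subset S1 <= S}.
    by move=> s sS; apply: sub; rewrite mem_cat sS.
  have sub2 : {subset S2 <= S}.
    by move=> s sS; apply: sub; rewrite mem_cat sS orbT.
  by apply: Fspan_add; [exact: H1|exact: H2].
- exists (S1 ++ S2) => S sub w Sw; rewrite appE.
  have sub1 : {subset S1 <= S}.
    by move=> s sS; apply: sub; rewrite mem_cat sS.
  have sub2 : {subset S2 <= S}.
    by move=> s sS; apply: sub; rewrite mem_cat sS orbT.
  by apply: H1 => //; exact: H2.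
- by exists S1 => S sub w Sw; rewrite appE; exact/Fspan_scale/H1.
Qed.

(** * Proof of the theorem *)

Lemma unit_form_F J w : unit_form (app (gF J) w) = 0.
Proof.
rewrite [w]monalgE; elim/big_ind: _ => [|w1 w2 h1 h2|p _].
- by rewrite app0 unit_form0.
- by rewrite appD unit_formD h1 h2 addr0.
have -> : mkmalgU p (mcoeff p w) = mcoeff p w *: ket p.
  apply/malgP => q.
  apply: (etrans (mcoeffU p _ q)); apply: (etrans _ (esym (mcoeffZ _ _ _))).
  have -> : mcoeff q (ket p) = 1 *+ (p == q) := mcoeffU p 1 q.
  by case: (p == q); rewrite ?mulr1n ?mulr0n ?mulr1 ?mulr0.
rewrite appZ unit_formZ /app (act_F hact) unit_form_F_op ?mulr0 //.
by case: J.
Qed.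

Lemma unit_form_Fspan S w : Fspan S w -> unit_form w = 0.
Proof.
elim=> {w} [|J w _ _ _|w w' _ IH _ IH'|k w _ IH].
- rewrite unit_form_ket; case: asboolP => // -[a].
  by move=> /(congr1 (fun f => f a)); rewrite itv_in //= ltrDl.
- exact: unit_form_F.
- by rewrite unit_formD IH IH' addr0.
- by rewrite unit_formZ IH mulr0.
Qed.

Lemma unit_form_orbit w :
  Uorbit act (ket (zero_pyramid K)) w -> unit_form w = 0.
Proof.
move=> [u _ <-]; elim/Uq_ind: u => x.
have [S H] := Fspan_expr x.
by apply: (@unit_form_Fspan S); apply: H => //; exact: Fspan_vac.
Qed.

End Action.

Lemma admissible_translate (R : realType) (K : set R) : admissible K ->
  forall x (m : int), K x -> K (x + m%:~R).
Proof.
case=> [->|->|[alpha [_ _ tr ->]]] x m //.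
  by move=> [q _ <-]; exists (q + m%:~R) => //; rewrite rmorphD /= ratr_int.
exact: tr.
Qed.

Lemma admissible0 (R : realType) (K : set R) : admissible K -> K 0.
Proof.
case=> [->|->|[alpha [_ z _ ->]]] //.
by exists 0 => //; rewrite rmorph0.
Qed.

Theorem proposition6p2 (R : realType) (K : set R) (hK : admissible K)
    (act : Uq K -> Fock K -> Fock K) (hact : is_Fock_action act) :
  Uorbit act (ket (zero_pyramid K)) `<` [set: Fock K].
Proof.
have KD := admissible_translate hK; have K0 := admissible0 hK.
have K1 : K 1 by have := KD 0 1 K0; rewrite add0r.
split=> // all.
have pyr : is_pyramid K \1_(interval_set (0, 0 + 1)).
  by apply: itv_is_pyramid; rewrite ?add0r.
pose w := ket_fun K \1_(interval_set (0, 0 + 1)).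
have := unit_form_orbit KD hact (all w I).
rewrite unit_form_ket_fun //; first by move/eqP; rewrite oner_eq0.
by exists 0.
Qed.
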